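(* Let $M$ be a path-connected pre-$\Delta$-monoid with identity $e$, let $\alpha_n\in\Omega(M,e)$ be a null-sequence, let $\beta,\beta':[0,1]\to M$ be paths from $e$ to $b$ that are path-homotopic, and let $\phi:\mathbb{N}\to\mathbb{N}$ be a bijection. Then $\mathcal{S}_\beta^{\alpha_n}\simeq\mathcal{S}_{\beta'}^{\alpha_{\phi(n)}}$ (path-homotopic).
   Context: A pre-$\Delta$-monoid is a space $M$ with an associative operation $\ast$ with identity $e$ such that for any continuous paths $\alpha,\beta:[0,1]\to M$, the pointwise product $t\mapsto\alpha(t)\ast\beta(t)$ is continuous. A sequence of loops $\alpha_n\in\Omega(M,e)$ is a null-sequence if every neighborhood of $e$ contains $\mathrm{Im}(\alpha_n)$ for all but finitely many $n$. Let $\mathcal{C}\subseteq[0,1]$ be the middle-thirds Cantor set and write $[0,1]\setminus\mathcal{C}=\bigcup_{m\ge1}\bigcup_{k=1}^{2^{m-1}}I_m^k$ (open intervals of length $3^{-m}$, indexed left to right for fixed $m$); set $I_n:=I_m^k$ where $n=2^{m-1}+k-1$ (this is a bijection between $\mathbb{N}$ and the components of $[0,1]\setminus\mathcal{C}$). Let $\Gamma:[0,1]\to[0,1]$ be the ternary Cantor function (constant on each $\overline{I_n}$), and $k_n:\overline{I_n}\to[0,1]$ the increasing linear homeomorphism. The transfinite slide of $\{\alpha_n\}$ along a path $\beta:[0,1]\to M$ with $\beta(0)=e$ is the path $\mathcal{S}_\beta^{\alpha_n}:[0,1]\to M$ given by $\mathcal{S}_\beta^{\alpha_n}(t)=\beta(\Gamma(t))$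 for $t\in\mathcal{C}$ and $\mathcal{S}_\beta^{\alpha_n}(t)=\beta(\Gamma(t))\ast\alpha_n(k_n(t))$ for $t\in I_n$. *)

(* Defs.v *)
From Stdlib Require Import Reals Lra Lia Arith Classical ClassicalEpsilon.
Open Scope R_scope.

Record TopSpace := {
  carrier :> Type;
  is_open : (carrier -> Prop) -> Prop;
  open_full : is_open (fun _ => True);
  open_inter : forall U V, is_open U -> is_open V -> is_open (fun x => U x /\ V x);
  open_union : forall F : (carrier -> Prop) -> Prop,
      (forall U, F U -> is_open U) -> is_open (fun x => exists U, F U /\ U x)
}.
Arguments is_open {_} _.

(** The unit interval [0,1] with its usual (metric subspace) topology.
    A path is a map [R -> X] whose restriction to [0,1] is continuous;
    values outside [0,1] are irrelevant. *)
Definition inI (t : R) : Prop := 0 <= t <= 1.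

Definition cont_I {X : TopSpace} (f : R -> X) : Prop :=
  forall U : X -> Prop, is_open U ->
  forall t, inI t -> U (f t) ->
  exists eps, 0 < eps /\ forall s, inI s -> Rabs (s - t) < eps -> U (f s).

Definition cont_I2 {X : TopSpace} (H : R -> R -> X) : Prop :=
  forall U : X -> Prop, is_open U ->
  forall s t, inI s -> inI t -> U (H s t) ->
  exists eps, 0 < eps /\ forall s' t', inI s' -> inI t' ->
     Rabs (s' - s) < eps -> Rabs (t' - t) < eps -> U (H s' t').

Definition is_path {X : TopSpace} (f : R -> X) (x y : X) : Prop :=
  cont_I f /\ f 0 = x /\ f 1 = y.

Definition path_connected (X : TopSpace) : Prop :=
  forall x y : X, exists f : R -> X, is_path f x y.

Definition path_homotopic {X : TopSpace} (f g : R -> X) : Prop :=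
  exists H : R -> R -> X, cont_I2 H /\
    (forall s, inI s -> H s 0 = f s) /\
    (forall s, inI s -> H s 1 = g s) /\
    (forall t, inI t -> H 0 t = f 0) /\
    (forall t, inI t -> H 1 t = f 1).

Record PreDeltaMonoid := {
  pdm_space :> TopSpace;
  pdm_op : pdm_space -> pdm_space -> pdm_space;
  pdm_e : pdm_space;
  pdm_assoc : forall x y z, pdm_op x (pdm_op y z) = pdm_op (pdm_op x y) z;
  pdm_idl : forall x, pdm_op pdm_e x = x;
  pdm_idr : forall x, pdm_op x pdm_e = x;
  pdm_paths : forall a b : R -> pdm_space, cont_I a -> cont_I b ->
      cont_I (fun t => pdm_op (a t) (b t))
}.
Arguments pdm_op {_} _ _.
Arguments pdm_e {_}.

Definition is_loop {M : PreDeltaMonoid} (a : R -> M) : Prop := is_path a pdm_e pdm_e.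

Definition null_sequence {M : PreDeltaMonoid} (alpha : nat -> R -> M) : Prop :=
  (forall n, is_loop (alpha n)) /\
  forall U : M -> Prop, is_open U -> U pdm_e ->
    exists N, forall n, (N <= n)%nat -> forall t, inI t -> U (alpha n t).

(** Left endpoint of the p-th (p = 0,1,...,2^d - 1, left to right) closed
    interval of stage d of the Cantor construction:
    sum_{i=1}^{d} 2*bit_{d-i}(p) 3^{-i}. *)
Fixpoint corner (d p : nat) : R :=
  match d with
  | O => 0
  | S d' => ((if Nat.testbit p d' then 2 else 0) + corner d' p) / 3
  end.

(** Index j : nat corresponds to the paper's index n = j+1 = 2^{m-1}+k-1,
    so m - 1 = lvl j and k - 1 = pos j. *)
Definition lvl (j : nat) : nat := Nat.log2 (S j).
Definition pos (j : nat) : nat := (S j - 2 ^ lvl j)%nat.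

Definition Ileft (j : nat) : R := corner (lvl j) (pos j) + (/ 3) ^ (S (lvl j)).
Definition Iright (j : nat) : R := corner (lvl j) (pos j) + 2 * (/ 3) ^ (S (lvl j)).

Definition in_gap (j : nat) (t : R) : Prop := Ileft j < t < Iright j.

Definition Cantor (t : R) : Prop := inI t /\ forall j, ~ in_gap j t.

(** Value of the Cantor function on the closure of I_m^k: (2k-1)/2^m. *)
Definition gap_value (j : nat) : R := INR (2 * pos j + 1) / 2 ^ (S (lvl j)).

Definition Rsup (E : R -> Prop) : R :=
  match excluded_middle_informative (exists l, is_lub E l) with
  | left H => proj1_sig (constructive_indefinite_description _ H)
  | right _ => 0
  end.

(** Ternary Cantor function: Gamma t = sup of the values taken on the removed
    intervals lying (weakly) to the left of t (and 0). It is constant, equal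
    to gap_value j, on the closure of each I_j. *)
Definition Gamma (t : R) : R :=
  Rsup (fun v => v = 0 \/ exists j, Ileft j <= t /\ v = gap_value j).

Definition kmap (j : nat) (t : R) : R := (t - Ileft j) / (Iright j - Ileft j).

Definition slide {M : PreDeltaMonoid} (beta : R -> M) (alpha : nat -> R -> M)
    (t : R) : M :=
  match excluded_middle_informative (exists j, in_gap j t) with
  | left H =>
      let j := proj1_sig (constructive_indefinite_description _ H) in
      pdm_op (beta (Gamma t)) (alpha j (kmap j t))
  | right _ => beta (Gamma t)   (* t in the Cantor set (or outside [0,1]) *)
  end.

(* Main.v *)
Require Import Defs.
From Stdlib Require Import Reals Lra Lia Arith ZArith Classical ClassicalEpsilon.
Open Scope R_scope.

(** Pointwise, the slide is the product of [beta o Gamma] and of the infinite concatenation A of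
    the loops over the gaps of the Cantor set, so it suffices to deform A into the concatenation
    A' of the permuted loops. Move the loops one after the other: during the strip
    [1 - 2^-n <= t <= 1 - 2^-(n+1)], [alpha n] travels from its old gap to its new one, while the
    later loops still sit in their old gaps and the earlier ones in their new gaps. At each point
    at most three loops overlap, and the homotopy is the pointwise product of these three layers.
    The operation need not be jointly continuous; continuity on the square, and at the limit
    [t = 1], is obtained by threading a path through a hypothetical sequence of bad points. *)

(** * Gaps and the Cantor function *)

(** Gaps indexed by level and position, which allows induction on the level; [Ileft j], [Iright j]
    and [gap_value j] are convertible to the case [lvl j], [pos j]. *)
Definition gl (d p : nat) : R := corner d p + (/ 3) ^ S d.
Definition gr (d p : nat) : R := corner d p + 2 * (/ 3) ^ S d.
Definition gv (d p : nat) : R := INR (2 * p + 1) / 2 ^ S d.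

Lemma corner_ext d p q :
  (forall i, (i < d)%nat -> Nat.testbit p i = Nat.testbit q i) ->
  corner d p = corner d q.
Proof.
  induction d as [|d IH]; intros H; simpl; [reflexivity|].
  rewrite (H d) by lia. rewrite IH; [reflexivity|]. intros; apply H; lia.
Qed.

(** Self-similarity: the top bit [b] of [p] selects one of the two copies of the Cantor set scaled
    by 1/3, while values are scaled by 1/2. *)
Lemma gap_split d p : (p < 2 ^ S d)%nat ->
  exists (b : R) (q : nat), (b = 0 \/ b = 1) /\ (q < 2 ^ d)%nat /\
    gl (S d) p = (2 * b + gl d q) / 3 /\ gr (S d) p = (2 * b + gr d q) / 3 /\
    gv (S d) p = (b + gv d q) / 2.
Proof.
  intros Hp.
  assert (P2 : (2 ^ S d = 2 * 2 ^ d)%nat) by reflexivity.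
  assert (Hpos : 0 < 2 ^ d) by (apply pow_lt; lra).
  assert (Hc : corner d (p mod 2 ^ d) = corner d p)
    by (apply corner_ext; intros i Hi; apply Nat.mod_pow2_bits_low; exact Hi).
  destruct (lt_dec p (2 ^ d)) as [Hlt|Hge].
  - exists 0, p. repeat split; auto; unfold gl, gr, gv; cbn [corner].
    1, 2: rewrite Nat.testbit_eqb, Nat.div_small by exact Hlt; simpl; lra.
    simpl; field; lra.
  - assert (Hdm : (p / 2 ^ d = 1)%nat)
      by (symmetry; apply (Nat.div_unique p (2 ^ d) 1 (p - 2 ^ d)); lia).
    assert (Hm : (p mod 2 ^ d = p - 2 ^ d)%nat)
      by (symmetry; apply (Nat.mod_unique p (2 ^ d) 1 (p - 2 ^ d)); lia).
    (* At level [d] only the low [d] bits matter, so [p mod 2 ^ d] has the same corner as [p]. *)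
    exists 1, (p - 2 ^ d)%nat. rewrite <- Hm at 2 3. unfold gl, gr, gv. rewrite Hc.
    cbn [corner]. rewrite Nat.testbit_eqb, Hdm. simpl Nat.eqb; cbv iota.
    repeat split; auto; [lia | simpl; lra | simpl; lra |].
    replace (2 * p + 1)%nat with (2 * (p - 2 ^ d) + 1 + 2 * 2 ^ d)%nat by lia.
    rewrite (plus_INR _ (2 * 2 ^ d)), mult_INR, pow_INR. simpl (INR 2).
    set (z := INR _). simpl. replace (1 + 1) with 2 by lra. field; lra.
Qed.

Lemma gap_0 p : (p < 2 ^ 0)%nat -> gl 0 p = /3 /\ gr 0 p = 2/3 /\ gv 0 p = /2.
Proof.
  intros Hp. assert (p = 0)%nat as -> by (simpl in Hp; lia).
  unfold gl, gr, gv; simpl; lra.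
Qed.

Lemma gap_bounds d p : (p < 2 ^ d)%nat ->
  0 < gl d p /\ gl d p < gr d p /\ gr d p < 1 /\ 0 < gv d p < 1.
Proof.
  revert p; induction d as [|d IH]; intros p Hp.
  - destruct (gap_0 p Hp) as (-> & -> & ->). lra.
  - destruct (gap_split d p Hp) as (b & q & Hb & Hq & -> & -> & ->).
    specialize (IH q Hq). lra.
Qed.

(** Descend by self-similarity until the gaps lie in different copies or one is the middle gap; the
    middle gap separates the copies both in position and in value. *)
Lemma gap_order d d' p p' : (p < 2 ^ d)%nat -> (p' < 2 ^ d')%nat ->
  gv d p < gv d' p' -> gr d p <= gl d' p'.
Proof.
  revert d' p p'; induction d as [|d IH]; intros [|d'] p p' Hp Hp' Hv.
  - pose proof (gap_0 p Hp). pose proof (gap_0 p' Hp'). lra.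
  - pose proof (gap_0 p Hp).
    destruct (gap_split d' p' Hp') as (b & q & Hb & Hq & E).
    pose proof (gap_bounds d' q Hq). lra.
  - pose proof (gap_0 p' Hp').
    destruct (gap_split d p Hp) as (b & q & Hb & Hq & E).
    pose proof (gap_bounds d q Hq). lra.
  - destruct (gap_split d p Hp) as (b & q & Hb & Hq & E).
    destruct (gap_split d' p' Hp') as (b' & q' & Hb' & Hq' & E').
    pose proof (gap_bounds d q Hq). pose proof (gap_bounds d' q' Hq').
    destruct Hb, Hb'; subst; try lra;
      assert (gr d q <= gl d' q') by (apply IH; auto; lra); lra.
Qed.

Lemma S_lvl_pos j : S j = (2 ^ lvl j + Defs.pos j)%nat /\ (Defs.pos j < 2 ^ lvl j)%nat.
Proof.
  unfold Defs.pos, lvl. pose proof (Nat.log2_spec (S j)). simpl (2 ^ S _)%nat in H. lia.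
Qed.

Lemma lvl_pos_inv d p : (p < 2 ^ d)%nat ->
  lvl (2 ^ d + p - 1) = d /\ Defs.pos (2 ^ d + p - 1) = p.
Proof.
  intros Hp. assert (2 ^ d <> 0)%nat by (apply Nat.pow_nonzero; lia).
  assert (Hl : lvl (2 ^ d + p - 1) = d).
  { unfold lvl. replace (S (2 ^ d + p - 1)) with (2 ^ d + p)%nat by lia.
    apply Nat.log2_unique; simpl; lia. }
  split; [exact Hl|]. unfold Defs.pos. rewrite Hl. lia.
Qed.

Lemma gap_j_bounds j :
  0 < Ileft j /\ Ileft j < Iright j /\ Iright j < 1 /\ 0 < gap_value j < 1.
Proof. exact (gap_bounds _ _ (proj2 (S_lvl_pos j))). Qed.

Lemma gap_j_order i j : gap_value i < gap_value j -> Iright i <= Ileft j.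
Proof.
  exact (gap_order _ _ _ _ (proj2 (S_lvl_pos i)) (proj2 (S_lvl_pos j))).
Qed.

Lemma odd_pow2_inj d d' p p' : ((2 * p + 1) * 2 ^ d = (2 * p' + 1) * 2 ^ d')%nat ->
  d = d' /\ p = p'.
Proof.
  revert d'; induction d as [|d IH]; intros [|d'] H; simpl in H; try lia.
  destruct (IH d') as [-> ->]; lia.
Qed.

(** The value is a dyadic fraction in lowest terms, so it determines level and position. *)
Lemma gap_value_inj i j : gap_value i = gap_value j -> i = j.
Proof.
  unfold gap_value. intros H.
  assert (Hi : 0 < 2 ^ S (lvl i)) by (apply pow_lt; lra).
  assert (Hj : 0 < 2 ^ S (lvl j)) by (apply pow_lt; lra).
  assert (E : INR (2 * Defs.pos i + 1) * 2 ^ S (lvl j) = INR (2 * Defs.pos j + 1) * 2 ^ S (lvl i)).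
  { transitivity (INR (2 * Defs.pos i + 1) / 2 ^ S (lvl i) * (2 ^ S (lvl i) * 2 ^ S (lvl j)));
      [field; lra|]. rewrite H. field; lra. }
  change 2 with (INR 2) in E. rewrite <- !pow_INR, <- !mult_INR in E.
  apply INR_eq, odd_pow2_inj in E. destruct E as [E1 E2].
  pose proof (proj1 (S_lvl_pos i)). pose proof (proj1 (S_lvl_pos j)).
  injection E1 as E1. rewrite E1, E2 in *. lia.
Qed.

Lemma in_gap_inj i j t : in_gap i t -> in_gap j t -> i = j.
Proof.
  unfold in_gap. intros Hi Hj.
  destruct (Rtotal_order (gap_value i) (gap_value j)) as [H|[H|H]].
  - apply gap_j_order in H; lra.
  - exact (gap_value_inj _ _ H).
  - apply gap_j_order in H; lra.
Qed.

(** Cancelling twos leads to an odd numerator, hence to a gap of level below [m]; the lower the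
    level, the longer the gap. *)
Lemma gap_value_dyadic m k : (0 < k < 2 ^ m)%nat ->
  exists j, gap_value j = INR k / 2 ^ m /\ (/ 3) ^ m <= Iright j - Ileft j.
Proof.
  revert k; induction m as [|m IH]; intros k Hk; [simpl in Hk; lia|].
  assert (0 < 2 ^ m) by (apply pow_lt; lra).
  assert (0 < (/ 3) ^ m) by (apply pow_lt; lra).
  simpl in Hk.
  destruct (Nat.Even_or_Odd k) as [[q ->]|[q ->]].
  - destruct (IH q) as (j & Hv & Hl); [lia|]. exists j. split.
    + rewrite Hv, mult_INR. simpl. field; lra.
    + simpl. lra.
  - destruct (lvl_pos_inv m q) as [E1 E2]; [lia|].
    exists (2 ^ m + q - 1)%nat. unfold gap_value, Iright, Ileft. rewrite E1, E2.
    split; [reflexivity|]. lra.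
Qed.

Lemma exists_pow_lt x eps : 0 <= x < 1 -> 0 < eps -> exists n, x ^ n < eps.
Proof.
  intros Hx He. destruct (pow_lt_1_zero x) with (y := eps) as [N HN]; auto.
  { rewrite Rabs_pos_eq; lra. }
  exists N. specialize (HN N (le_n N)). rewrite Rabs_pos_eq in HN; auto.
  apply pow_le; lra.
Qed.

(** The leftmost gaps of the successive levels shrink to 0. They let a path built over the gaps
    probe every neighbourhood of its starting point. *)
Lemma gap_near_0 eps : 0 < eps -> exists j, Iright j < eps.
Proof.
  intros He. destruct (exists_pow_lt (/ 3) eps) as [m Hm]; [lra|auto|].
  assert (Hz : forall d, corner d 0 = 0).
  { induction d as [|d IH]; simpl; [reflexivity|]. rewrite IH, Nat.bits_0. lra. }
  destruct (lvl_pos_inv m 0) as [E1 E2]; [apply Nat.neq_0_lt_0, Nat.pow_nonzero; lia|].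
  exists (2 ^ m + 0 - 1)%nat. unfold Iright. rewrite E1, E2, Hz.
  assert (0 < (/ 3) ^ m) by (apply pow_lt; lra). simpl. lra.
Qed.

(** The default branch of [Rsup] is never taken: the set contains 0 and is bounded by 1. *)
Lemma Gamma_lub t :
  is_lub (fun v => v = 0 \/ exists j, Ileft j <= t /\ v = gap_value j) (Gamma t).
Proof.
  unfold Gamma, Rsup.
  destruct (excluded_middle_informative _) as [H|H].
  - apply (proj2_sig (constructive_indefinite_description _ H)).
  - exfalso. apply H. edestruct completeness as [l Hl].
    3: exists l; exact Hl.
    + exists 1. intros v [->|(j & _ & ->)]; [lra|]. destruct (gap_j_bounds j); lra.
    + exists 0. now left.
Qed.

Lemma Gamma_ge t j : Ileft j <= t -> gap_value j <= Gamma t.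
Proof. intros H. apply Gamma_lub. eauto. Qed.

Lemma Gamma_le t M : 0 <= M -> (forall j, Ileft j <= t -> gap_value j <= M) -> Gamma t <= M.
Proof. intros HM H. apply Gamma_lub. intros v [->|(j & Hj & ->)]; auto. Qed.

Lemma Gamma_in t : inI (Gamma t).
Proof.
  split; [apply Gamma_lub; now left|].
  apply Gamma_le; [lra|]. intros j _. destruct (gap_j_bounds j); lra.
Qed.

Lemma Gamma_mono s t : s <= t -> Gamma s <= Gamma t.
Proof.
  intros H. apply Gamma_le; [apply Gamma_in|]. intros j Hj. apply Gamma_ge; lra.
Qed.

(* If Gamma increased by more than 2/2^m, two consecutive dyadics k/2^m, (k+1)/2^m
   would lie strictly in between, and the whole gap of value k/2^m inside [s,t]. *)
Lemma Gamma_modulus m s t : s <= t -> t - s < (/ 3) ^ m -> Gamma t <= Gamma s + 2 / 2 ^ m.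
Proof.
  intros Hst Hlt. apply Rnot_lt_le. intros Hbad.
  assert (Hm : 0 < 2 ^ m) by (apply pow_lt; lra).
  pose proof (Gamma_in s). pose proof (Gamma_in t). unfold inI in *.
  assert (Hx : 0 <= Gamma s * 2 ^ m) by (apply Rmult_le_pos; lra).
  destruct (archimed (Gamma s * 2 ^ m)) as [Hu1 Hu2].
  set (z := up (Gamma s * 2 ^ m)) in *.
  assert (Hz : (0 < z)%Z) by (apply lt_IZR; lra).
  set (k := Z.to_nat z).
  assert (Hk : INR k = IZR z) by (unfold k; rewrite INR_IZR_INZ, Z2Nat.id; auto; lia).
  assert (Hs : Gamma s * 2 ^ m < INR k) by lra.
  assert (Ht : INR k + 1 < Gamma t * 2 ^ m).
  { apply Rle_lt_trans with (Gamma s * 2 ^ m + 2); [lra|].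
    apply (Rmult_lt_compat_r (2 ^ m)) in Hbad; auto.
    replace ((Gamma s + 2 / 2 ^ m) * 2 ^ m) with (Gamma s * 2 ^ m + 2) in Hbad
      by (field; lra). exact Hbad. }
  assert (Hk1 : (S k < 2 ^ m)%nat).
  { apply INR_lt. rewrite S_INR, pow_INR. simpl (INR 2).
    apply Rlt_le_trans with (1 := Ht). replace (1 + 1) with 2 by lra. nra. }
  destruct (gap_value_dyadic m k) as (i & Hi & Li); [unfold k; lia|].
  destruct (gap_value_dyadic m (S k)) as (j & Hj & Lj); [lia|].
  rewrite S_INR in Hj.
  assert (A1 : s < Ileft i).
  { apply Rnot_le_lt. intros C. apply Gamma_ge in C. rewrite Hi in C.
    apply (Rmult_le_compat_r (2 ^ m)) in C; [|lra].
    replace (INR k / 2 ^ m * 2 ^ m) with (INR k) in C by (field; lra). lra. }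
  assert (A2 : Iright i <= Ileft j).
  { apply gap_j_order. rewrite Hi, Hj. apply Rmult_lt_compat_r; [|lra].
    apply Rinv_0_lt_compat; auto. }
  (* If gap [j] began after [t], no gap beginning by [t] could have a larger value, and [Gamma t]
     could not exceed [(k + 1) / 2 ^ m]. *)
  assert (A3 : Ileft j <= t).
  { apply Rnot_lt_le. intros C.
    assert (D : Gamma t <= gap_value j).
    { apply Gamma_le; [destruct (gap_j_bounds j); lra|]. intros l Hl.
      apply Rnot_lt_le. intros E. apply gap_j_order in E.
      pose proof (gap_j_bounds j). lra. }
    rewrite Hj in D. apply (Rmult_le_compat_r (2 ^ m)) in D; [|lra].
    replace ((INR k + 1) / 2 ^ m * 2 ^ m) with (INR k + 1) in D by (field; lra). lra. }
  lra.
Qed.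

Lemma Gamma_continuous eps : 0 < eps -> exists delta, 0 < delta /\
  forall s t, Rabs (s - t) < delta -> Rabs (Gamma s - Gamma t) < eps.
Proof.
  intros He. destruct (exists_pow_lt (/ 2) (eps / 2)) as [m Hm]; [lra|lra|].
  rewrite pow_inv in Hm.
  exists ((/ 3) ^ m). split; [apply pow_lt; lra|]. intros s t Hst.
  destruct (Rle_dec s t) as [C|C].
  - pose proof (Gamma_mono s t C).
    assert (Gamma t <= Gamma s + 2 / 2 ^ m)
      by (apply Gamma_modulus; auto; revert Hst; split_Rabs; lra).
    split_Rabs; lra.
  - pose proof (Gamma_mono t s ltac:(lra)).
    assert (Gamma s <= Gamma t + 2 / 2 ^ m)
      by (apply Gamma_modulus; [lra|revert Hst; split_Rabs; lra]).
    split_Rabs; lra.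
Qed.

Lemma Gamma_0 : Gamma 0 = 0.
Proof.
  apply Rle_antisym; [|apply Gamma_in].
  apply Gamma_le; [lra|]. intros j Hj. destruct (gap_j_bounds j); lra.
Qed.

Lemma Gamma_1 : Gamma 1 = 1.
Proof.
  apply Rle_antisym; [apply Gamma_in|]. apply Rnot_lt_le. intros C.
  destruct (exists_pow_lt (/ 2) (1 - Gamma 1)) as [m Hm]; [lra|lra|].
  assert (H0 : Gamma 1 >= 0) by (destruct (Gamma_in 1); lra).
  destruct m as [|m]; [simpl in Hm; lra|].
  assert (P : (2 ^ m <> 0)%nat) by (apply Nat.pow_nonzero; lia).
  (* The largest dyadic below 1 with this denominator is a gap value and already exceeds
     [Gamma 1]. *)
  destruct (gap_value_dyadic (S m) (2 ^ S m - 1)) as (j & Hj & _); [simpl; lia|].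
  rewrite minus_INR, pow_INR in Hj by (simpl; lia). simpl (INR 2) in Hj.
  replace (1 + 1) with 2 in Hj by lra. simpl (INR 1) in Hj.
  assert (0 < 2 ^ S m) by (apply pow_lt; lra).
  assert (gap_value j <= Gamma 1) by (apply Gamma_ge; destruct (gap_j_bounds j); lra).
  rewrite pow_inv in Hm.
  replace ((2 ^ S m - 1) / 2 ^ S m) with (1 - / 2 ^ S m) in Hj by (field; lra). lra.
Qed.

(** * Infinite concatenation over the gaps *)

(** Gives one radius for the finitely many loops outside a null tail, and later for finitely many
    time strips. *)
Lemma min_radius (P : nat -> R -> Prop) (N : nat) :
  (forall n e e', P n e -> 0 < e' <= e -> P n e') ->
  (forall n, (n < N)%nat -> exists e, 0 < e /\ P n e) ->
  exists e, 0 < e /\ forall n, (n < N)%nat -> P n e.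
Proof.
  intros Hmono. induction N as [|N IH]; intros H.
  - exists 1. split; [lra|]. intros; lia.
  - destruct IH as (e1 & He1 & H1); [intros; apply H; lia|].
    destruct (H N) as (e2 & He2 & H2); [lia|].
    assert (0 < Rmin e1 e2) by (apply Rmin_glb_lt; auto).
    exists (Rmin e1 e2). split; auto. intros n Hn.
    destruct (Nat.eq_dec n N) as [->|Hne].
    + apply Hmono with e2; auto. split; auto; apply Rmin_r.
    + apply Hmono with e1; [apply H1; lia|]. split; auto; apply Rmin_l.
Qed.

Lemma inv_S_small eps : 0 < eps -> exists N, forall n, (N <= n)%nat -> / INR (S n) < eps.
Proof.
  intros He. destruct (archimed_cor1 eps He) as (N & HN & Hpos).
  exists N. intros n Hn. apply Rle_lt_trans with (2 := HN).
  apply Rinv_le_contravar; [apply lt_0_INR; lia|apply le_INR; lia].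
Qed.

Lemma inv_S_bounds n : 0 < / INR (S n) <= 1.
Proof.
  assert (1 <= INR (S n)) by (rewrite S_INR; pose proof (pos_INR n); lra).
  split; [apply Rinv_0_lt_compat; lra|].
  rewrite <- Rinv_1. apply Rinv_le_contravar; lra.
Qed.

Definition clamp (x : R) : R := Rmax 0 (Rmin 1 x).

Ltac clamp_tac := unfold clamp, inI, Rmax, Rmin; repeat destruct (Rle_dec _ _);
  try split_Rabs; lra.

Lemma clamp_in x : inI (clamp x).
Proof. clamp_tac. Qed.

Lemma clamp_lip x y : Rabs (clamp x - clamp y) <= Rabs (x - y).
Proof. clamp_tac. Qed.

Lemma clamp_id x : inI x -> clamp x = x.
Proof. clamp_tac. Qed.

Lemma clamp_le0 x : x <= 0 -> clamp x = 0.
Proof. clamp_tac. Qed.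

Lemma clamp_ge1 x : 1 <= x -> clamp x = 1.
Proof. clamp_tac. Qed.

(** Clamping makes [f (gap_coord j t)] a function on the whole line that equals the base point of
    the loop [f] off gap [j]. *)
Definition gap_coord (j : nat) (t : R) : R := clamp (kmap j t).

Lemma gap_coord_in_gap j t : in_gap j t -> gap_coord j t = kmap j t.
Proof.
  intros H. destruct (gap_j_bounds j) as (_ & Hlr & _). apply clamp_id.
  unfold in_gap, kmap, inI in *. split.
  - apply Rmult_le_pos; [lra|]. left; apply Rinv_0_lt_compat; lra.
  - apply Rmult_le_reg_r with (Iright j - Ileft j); [lra|].
    unfold Rdiv. rewrite Rmult_assoc, Rinv_l; lra.
Qed.

Lemma gap_coord_out j t : ~ in_gap j t -> gap_coord j t = 0 \/ gap_coord j t = 1.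
Proof.
  intros H. destruct (gap_j_bounds j) as (_ & Hlr & _).
  assert (0 < / (Iright j - Ileft j)) by (apply Rinv_0_lt_compat; lra).
  destruct (Rle_dec t (Ileft j)) as [C|C].
  - left. apply clamp_le0. unfold kmap, Rdiv. nra.
  - right. apply clamp_ge1. unfold kmap.
    assert (Iright j <= t) by (apply Rnot_lt_le; intros ?; apply H; split; lra).
    apply Rmult_le_reg_r with (Iright j - Ileft j); [lra|].
    unfold Rdiv. rewrite Rmult_assoc, Rinv_l; lra.
Qed.

Lemma gap_coord_0 j : gap_coord j 0 = 0.
Proof.
  destruct (gap_j_bounds j) as (Hl & Hlr & _). apply clamp_le0. unfold kmap, Rdiv.
  assert (0 < / (Iright j - Ileft j)) by (apply Rinv_0_lt_compat; lra). nra.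
Qed.

Lemma gap_coord_1 j : gap_coord j 1 = 1.
Proof.
  destruct (gap_j_bounds j) as (Hl & Hlr & Hr & _). apply clamp_ge1. unfold kmap.
  apply Rmult_le_reg_r with (Iright j - Ileft j); [lra|].
  unfold Rdiv. rewrite Rmult_assoc, Rinv_l; lra.
Qed.

Lemma gap_coord_lip j : exists L, 0 < L /\
  forall s t, Rabs (gap_coord j s - gap_coord j t) <= L * Rabs (s - t).
Proof.
  destruct (gap_j_bounds j) as (_ & Hlr & _).
  assert (0 < / (Iright j - Ileft j)) by (apply Rinv_0_lt_compat; lra).
  exists (/ (Iright j - Ileft j)). split; auto. intros s t.
  eapply Rle_trans; [apply clamp_lip|]. right.
  replace (kmap j s - kmap j t) with (/ (Iright j - Ileft j) * (s - t))
    by (unfold kmap; field; lra).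
  rewrite Rabs_mult, (Rabs_pos_eq (/ _)); lra.
Qed.

Definition mid (j : nat) : R := (Ileft j + Iright j) / 2.

Lemma mid_in_gap j : in_gap j (mid j).
Proof. destruct (gap_j_bounds j) as (_ & H & _). unfold in_gap, mid. lra. Qed.

Lemma kmap_mid j : kmap j (mid j) = / 2.
Proof. destruct (gap_j_bounds j) as (_ & H & _). unfold kmap, mid. field. lra. Qed.

Lemma cont_I_comp {X : TopSpace} (f : R -> X) (g : R -> R) (L : R) :
  cont_I f -> 0 < L -> (forall t, inI t -> inI (g t)) ->
  (forall s t, Rabs (g s - g t) <= L * Rabs (s - t)) -> cont_I (fun t => f (g t)).
Proof.
  intros Hf HL Hg Hlip U HU t Ht HUt.
  destruct (Hf U HU (g t) (Hg t Ht) HUt) as (e & He & H).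
  exists (e / L). split; [apply Rdiv_lt_0_compat; auto|]. intros s Hs Hst.
  apply H; auto. eapply Rle_lt_trans; [apply Hlip|].
  apply Rmult_lt_compat_l with (r := L) in Hst; auto.
  replace (L * (e / L)) with e in Hst by (field; lra). exact Hst.
Qed.

Lemma cont_I_const {X : TopSpace} (x : X) : cont_I (fun _ => x).
Proof. intros U _ t _ HU. exists 1. split; [lra|auto]. Qed.

(** The notion of [null_sequence] for any space and base point: it is also applied to spikes in the
    square and to loops based at points of a path. *)
Definition null_at {X : TopSpace} (x : X) (f : nat -> R -> X) : Prop :=
  (forall n, is_path (f n) x x) /\
  forall U : X -> Prop, is_open U -> U x ->
    exists N, forall n, (N <= n)%nat -> forall t, inI t -> U (f n t).

(** The slide without its [beta] factor, hence meaningful in any space. *)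
Definition concat {X : TopSpace} (x : X) (f : nat -> R -> X) (t : R) : X :=
  match excluded_middle_informative (exists j, in_gap j t) with
  | left H => let j := proj1_sig (constructive_indefinite_description _ H) in
      f j (kmap j t)
  | right _ => x
  end.

Lemma concat_gap {X : TopSpace} (x : X) f j t : in_gap j t -> concat x f t = f j (gap_coord j t).
Proof.
  intros Hj. unfold concat. destruct (excluded_middle_informative _) as [H|H].
  - destruct (constructive_indefinite_description _ H) as [i Hi]; simpl.
    rewrite (in_gap_inj i j t Hi Hj), gap_coord_in_gap; auto.
  - exfalso; eauto.
Qed.

Lemma concat_out {X : TopSpace} (x : X) f t : ~ (exists j, in_gap j t) -> concat x f t = x.
Proof. intros Hn. unfold concat. destruct (excluded_middle_informative _); tauto. Qed.

Lemma concat_mid {X : TopSpace} (x : X) f j : concat x f (mid j) = f j (/ 2).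
Proof.
  rewrite (concat_gap x f j), gap_coord_in_gap, kmap_mid; auto using mid_in_gap.
Qed.

Lemma in_gap_nbhd j t : in_gap j t -> exists e, 0 < e /\ forall s, Rabs (s - t) < e -> in_gap j s.
Proof.
  intros [H1 H2]. exists (Rmin (t - Ileft j) (Iright j - t)).
  split; [apply Rmin_glb_lt; lra|]. intros s Hs.
  pose proof (Rmin_l (t - Ileft j) (Iright j - t)).
  pose proof (Rmin_r (t - Ileft j) (Iright j - t)).
  split; revert Hs; split_Rabs; lra.
Qed.

Lemma loop_gap_coord_out {X : TopSpace} (x : X) f j t :
  is_path f x x -> ~ in_gap j t -> f (gap_coord j t) = x.
Proof. intros (_ & H0 & H1) Ht. destruct (gap_coord_out j t Ht) as [-> | ->]; auto. Qed.

(** Inside a gap only one loop matters. Elsewhere the value is [x]: a tail of the loops stays in [U]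
    entirely, and the finitely many others are continuous at [t] with value [x]. *)
Lemma concat_cont {X : TopSpace} (x : X) f : null_at x f -> cont_I (concat x f).
Proof.
  intros [Hl Hnull] U HU t Ht HUt.
  assert (Hc : forall j, cont_I (fun s => f j (gap_coord j s))).
  { intros j. destruct (gap_coord_lip j) as (L & HL & Hlip).
    apply cont_I_comp with L; auto; [apply Hl|]. intros; apply clamp_in. }
  destruct (classic (exists j, in_gap j t)) as [[j Hj]|Hn].
  - rewrite (concat_gap x f j t Hj) in HUt.
    destruct (Hc j U HU t Ht HUt) as (e1 & He1 & H1).
    destruct (in_gap_nbhd j t Hj) as (e2 & He2 & H2).
    exists (Rmin e1 e2). split; [apply Rmin_glb_lt; auto|]. intros s Hs Hst.
    pose proof (Rmin_l e1 e2). pose proof (Rmin_r e1 e2).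
    rewrite (concat_gap x f j s); [apply H1|apply H2]; auto; lra.
  - rewrite concat_out in HUt by exact Hn.
    destruct (Hnull U HU HUt) as [N HN].
    destruct (min_radius (fun n e => forall s, inI s -> Rabs (s - t) < e ->
      U (f n (gap_coord n s))) N) as (e & He & H).
    + intros n e e' H Hee s Hs Hst. apply H; auto; lra.
    + intros n _. apply (Hc n U HU t Ht).
      rewrite (loop_gap_coord_out x); auto. intros C; apply Hn; eauto.
    + exists e. split; auto. intros s Hs Hst.
      destruct (classic (exists j, in_gap j s)) as [[j Hj]|Hns].
      * rewrite (concat_gap x f j s Hj). destruct (le_lt_dec N j).
        -- apply HN; auto. apply clamp_in.
        -- apply H; auto.
      * rewrite concat_out; auto.
Qed.

Lemma no_gap_0 : ~ exists j, in_gap j 0.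
Proof. intros [j [H _]]. destruct (gap_j_bounds j). lra. Qed.

Lemma no_gap_1 : ~ exists j, in_gap j 1.
Proof. intros [j [_ H]]. destruct (gap_j_bounds j) as (_ & _ & H' & _). lra. Qed.

(** The device for threading bad points: placed at the midpoints of the gaps, they cannot all avoid
    an open set containing the start of the path, since the midpoints accumulate at 0. *)
Lemma path_mid {X : TopSpace} (p : R -> X) (U : X -> Prop) :
  cont_I p -> is_open U -> U (p 0) -> exists j, U (p (mid j)).
Proof.
  intros Hp HU H0. destruct (Hp U HU 0) as (e & He & H); auto; [unfold inI; lra|].
  destruct (gap_near_0 e He) as [j Hj]. exists j.
  destruct (gap_j_bounds j) as (B1 & B2 & B3 & _).
  apply H; unfold mid, inI; [lra|]. rewrite Rabs_pos_eq; lra.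
Qed.

(** * Spike loops and the square tested by paths *)

Definition tent (t : R) : R := 1 - Rabs (2 * t - 1).

Lemma tent_in t : inI t -> inI (tent t).
Proof. unfold inI, tent; split_Rabs; lra. Qed.

Lemma tent_lip s t : Rabs (tent s - tent t) <= 2 * Rabs (s - t).
Proof. unfold tent; split_Rabs; lra. Qed.

Lemma tent_ends : tent 0 = 0 /\ tent 1 = 0 /\ tent (/ 2) = 1.
Proof. unfold tent; repeat split; split_Rabs; lra. Qed.

(** Runs from [x] to [y] and back, so that over a gap the point [y] is reached at the midpoint. *)
Definition spike (x y t : R) : R := x + (y - x) * tent t.

Lemma spike_in x y t : inI x -> inI y -> inI t -> inI (spike x y t).
Proof.
  intros Hx Hy Ht. apply tent_in in Ht. unfold inI, spike in *. nra.
Qed.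

Lemma spike_ends x y : spike x y 0 = x /\ spike x y 1 = x /\ spike x y (/ 2) = y.
Proof. unfold spike. destruct tent_ends as (-> & -> & ->). repeat split; ring. Qed.

Lemma spike_lip x y s t : inI x -> inI y ->
  Rabs (spike x y s - spike x y t) <= 2 * Rabs (s - t).
Proof.
  intros Hx Hy. unfold spike.
  replace (x + (y - x) * tent s - (x + (y - x) * tent t))
    with ((y - x) * (tent s - tent t)) by ring.
  rewrite Rabs_mult. pose proof (tent_lip s t). pose proof (Rabs_pos (tent s - tent t)).
  assert (Rabs (y - x) <= 1) by (unfold inI in *; split_Rabs; lra).
  pose proof (Rabs_pos (y - x)). nra.
Qed.

Lemma spike_near x y t : inI t -> Rabs (spike x y t - x) <= Rabs (y - x).
Proof.
  intros Ht. apply tent_in in Ht. unfold spike, inI in *.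
  replace (x + (y - x) * tent t - x) with ((y - x) * tent t) by ring.
  rewrite Rabs_mult, (Rabs_pos_eq (tent t)) by lra. pose proof (Rabs_pos (y - x)). nra.
Qed.

(** Points outside the unit square are unconstrained, so preimages of opens under [H] are open
    exactly when [cont_I2 H] holds. *)
Definition square_open (U : R * R -> Prop) : Prop :=
  forall s t, inI s -> inI t -> U (s, t) -> exists e, 0 < e /\
    forall s' t', inI s' -> inI t' -> Rabs (s' - s) < e -> Rabs (t' - t) < e -> U (s', t').

Program Definition Square : TopSpace :=
  {| carrier := R * R; is_open := square_open |}.
Next Obligation. intros s t _ _ _. exists 1. split; [lra|auto]. Qed.
Next Obligation.
  intros s t Hs Ht [HU HV].
  destruct (H s t Hs Ht HU) as (e1 & He1 & H1), (H0 s t Hs Ht HV) as (e2 & He2 & H2).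
  exists (Rmin e1 e2). split; [apply Rmin_glb_lt; auto|]. intros s' t' Hs' Ht' Ds Dt.
  pose proof (Rmin_l e1 e2). pose proof (Rmin_r e1 e2).
  split; [apply H1|apply H2]; auto; lra.
Qed.
Next Obligation.
  intros s t Hs Ht (U & HF & HU). destruct (H U HF s t Hs Ht HU) as (e & He & H1).
  exists e. split; auto. intros. exists U. auto.
Qed.

Lemma cont_I2_open {X : TopSpace} (H : R -> R -> X) (U : X -> Prop) :
  cont_I2 H -> is_open U -> is_open (t := Square) (fun p => U (H (fst p) (snd p))).
Proof. intros HH HU s t Hs Ht HUst. exact (HH U HU s t Hs Ht HUst). Qed.

Lemma cont_I2_along {X : TopSpace} (H : R -> R -> X) (p : R -> Square) :
  cont_I2 H -> cont_I p -> cont_I (fun t => H (fst (p t)) (snd (p t))).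
Proof. intros HH Hp U HU. exact (Hp _ (cont_I2_open H U HH HU)). Qed.

(** A spike stays as close to its base as its tip, so convergence of the tips makes the loops
    null. *)
Lemma spike_null (s t : R) (u v : nat -> R) : inI s -> inI t ->
  (forall n, inI (u n) /\ Rabs (u n - s) < / INR (S n)) ->
  (forall n, inI (v n) /\ Rabs (v n - t) < / INR (S n)) ->
  null_at (X := Square) (s, t) (fun n x => (spike s (u n) x, spike t (v n) x)).
Proof.
  intros Hs Ht Hu Hv. split.
  - intros n. destruct (Hu n) as [Iu _], (Hv n) as [Iv _].
    split; [|split; apply f_equal2; apply spike_ends]. intros U HU x Hx HUx.
    destruct (HU _ _ (spike_in s (u n) x Hs Iu Hx) (spike_in t (v n) x Ht Iv Hx) HUx)
      as (e & He & H).
    exists (e / 2). split; [lra|]. intros y Hy Hxy.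
    pose proof (spike_lip s (u n) y x Hs Iu). pose proof (spike_lip t (v n) y x Ht Iv).
    apply H; try apply spike_in; auto; lra.
  - intros U HU HUx. destruct (HU s t Hs Ht HUx) as (e & He & H).
    destruct (inv_S_small e He) as [N HN]. exists N. intros n Hn x Hx.
    destruct (Hu n) as [Iu Du], (Hv n) as [Iv Dv]. specialize (HN n Hn).
    pose proof (spike_near s (u n) x Hx). pose proof (spike_near t (v n) x Hx).
    apply H; try apply spike_in; auto; lra.
Qed.

(** The square is Delta-generated: its opens are detected by the paths in it. *)
Lemma cont_I2_intro {X : TopSpace} (H : R -> R -> X) :
  (forall p : R -> Square, cont_I p -> cont_I (fun t => H (fst (p t)) (snd (p t)))) ->
  cont_I2 H.
Proof.
  intros Hp U HU s t Hs Ht HUst. apply NNPP. intros Hbad.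
  assert (Hz : forall n : nat, exists z : R * R, inI (fst z) /\ inI (snd z) /\
    Rabs (fst z - s) < / INR (S n) /\ Rabs (snd z - t) < / INR (S n) /\
    ~ U (H (fst z) (snd z))).
  { intros n. apply NNPP. intros C. apply Hbad. exists (/ INR (S n)).
    split; [apply inv_S_bounds|]. intros s' t' Hs' Ht' Ds Dt. apply NNPP. intros C'.
    apply C. exists (s', t'). auto. }
  destruct (choice _ Hz) as [z Hzz].
  (* Spikes at [(s, t)] through the bad points form a null sequence; the image under [H] of their
     concatenation enters [U] at some midpoint, which is a bad point. *)
  assert (Hnull := spike_null s t (fun n => fst (z n)) (fun n => snd (z n)) Hs Ht
    (fun n => conj (proj1 (Hzz n)) (proj1 (proj2 (proj2 (Hzz n)))))
    (fun n => conj (proj1 (proj2 (Hzz n))) (proj1 (proj2 (proj2 (proj2 (Hzz n))))))).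
  destruct (path_mid _ U (Hp _ (concat_cont _ _ Hnull)) HU) as [j Hj].
  - rewrite concat_out by apply no_gap_0. exact HUst.
  - rewrite concat_mid in Hj. cbn [fst snd] in Hj.
    destruct (spike_ends s (fst (z j))) as (_ & _ & E1).
    destruct (spike_ends t (snd (z j))) as (_ & _ & E2).
    rewrite E1, E2 in Hj. destruct (Hzz j) as (_ & _ & _ & _ & Hno). auto.
Qed.

(** The axiom on products of paths suffices because continuity on the square is tested along
    paths. *)
Lemma cont_I2_mul {M : PreDeltaMonoid} (F G : R -> R -> M) :
  cont_I2 F -> cont_I2 G -> cont_I2 (fun s t => pdm_op (F s t) (G s t)).
Proof.
  intros HF HG. apply cont_I2_intro. intros p Hp.
  apply (pdm_paths M (fun t => F (fst (p t)) (snd (p t))) (fun t => G (fst (p t)) (snd (p t))));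
    apply cont_I2_along; auto.
Qed.

Lemma cont_I2_fst {X : TopSpace} (f : R -> X) : cont_I f -> cont_I2 (fun s _ => f s).
Proof.
  intros Hf U HU s t Hs Ht HUs. destruct (Hf U HU s Hs HUs) as (e & He & H).
  exists e. split; auto.
Qed.

(** * Moving the loops one at a time *)

Lemma cont_I2_comp {X : TopSpace} (f : R -> X) (h : R -> R -> R) (L : R) :
  cont_I f -> 0 < L -> (forall s t, inI s -> inI t -> inI (h s t)) ->
  (forall s t s' t', Rabs (h s' t' - h s t) <= L * (Rabs (s' - s) + Rabs (t' - t))) ->
  cont_I2 (fun s t => f (h s t)).
Proof.
  intros Hf HL Hh Hlip U HU s t Hs Ht HUst.
  destruct (Hf U HU (h s t) (Hh s t Hs Ht) HUst) as (e & He & H).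
  assert (0 < e / (2 * L)) by (apply Rdiv_lt_0_compat; lra).
  exists (e / (2 * L)). split; auto. intros s' t' Hs' Ht' Ds Dt.
  apply H; auto. eapply Rle_lt_trans; [apply Hlip|].
  apply Rlt_le_trans with (L * (e / (2 * L) + e / (2 * L))).
  - apply Rmult_lt_compat_l; lra.
  - right. field. lra.
Qed.

Lemma slide_concat {M : PreDeltaMonoid} (beta : R -> M) (alpha : nat -> R -> M) t :
  slide beta alpha t = pdm_op (beta (Gamma t)) (concat pdm_e alpha t).
Proof.
  unfold slide, concat. destruct (excluded_middle_informative _); [reflexivity|].
  symmetry; apply pdm_idr.
Qed.

(** At each point at most one of the two factors differs from the identity, so they commute. Both
    orders are used: on the right for a loop leaving the waiting layer, on the left for one joining
    the moved layer. *)
Lemma concat_peel {M : PreDeltaMonoid} (f f' : nat -> R -> M) (j : nat) (t : R) :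
  is_loop (f j) -> (forall s, f' j s = pdm_e) ->
  (forall i, i <> j -> forall s, f i s = f' i s) ->
  concat pdm_e f t = pdm_op (concat pdm_e f' t) (f j (gap_coord j t)) /\
  concat pdm_e f t = pdm_op (f j (gap_coord j t)) (concat pdm_e f' t).
Proof.
  intros Hl Hj Hi. destruct (classic (exists i, in_gap i t)) as [[i Ht]|Hn].
  - rewrite !(concat_gap _ _ i t Ht). destruct (Nat.eq_dec i j) as [->|Hne].
    + rewrite Hj, pdm_idl, pdm_idr. auto.
    + rewrite (loop_gap_coord_out pdm_e (f j) j t Hl), Hi, pdm_idl, pdm_idr by
        (auto; intros C; apply Hne; exact (in_gap_inj _ _ _ Ht C)). auto.
  - rewrite !concat_out, (loop_gap_coord_out pdm_e (f j) j t Hl), pdm_idl by eauto. auto.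
Qed.

(** Deselected loops become constant instead of being dropped, so that the others keep their
    gaps. *)
Definition keep {X : TopSpace} (x : X) (c : nat -> bool) (f : nat -> R -> X) (j : nat) : R -> X :=
  if c j then f j else fun _ => x.

Lemma keep_null {X : TopSpace} (x : X) c f : null_at x f -> null_at x (keep x c f).
Proof.
  intros [Hl Hn]. split.
  - intros n. unfold keep. destruct (c n); auto. repeat split. apply cont_I_const.
  - intros U HU Hx. destruct (Hn U HU Hx) as [N HN]. exists N. intros n Hle t Ht.
    unfold keep. destruct (c n); auto.
Qed.

(** An index [n] with [phi n < N] is the image under [psi] of a number below [N], and these finitely
    many images are bounded. *)
Lemma null_at_reindex {X : TopSpace} (x : X) f (phi psi : nat -> nat) :
  (forall n, psi (phi n) = n) -> null_at x f -> null_at x (fun n => f (phi n)).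
Proof.
  intros Hpsi [Hl Hn]. split; [auto|]. intros U HU Hx.
  destruct (Hn U HU Hx) as [N HN].
  assert (B : exists B, forall m, (m < N)%nat -> (psi m < B)%nat).
  { clear HN. induction N as [|N [B IH]]; [exists 0%nat; intros; lia|].
    exists (S (B + psi N)). intros m Hm. destruct (Nat.eq_dec m N) as [->|]; [lia|].
    specialize (IH m); lia. }
  destruct B as [B HB]. exists B. intros n Hle t Ht. apply HN; auto.
  apply Nat.nlt_ge. intros C. apply HB in C. rewrite Hpsi in C. lia.
Qed.

(** Replaces joint continuity of the operation at [(x, y, z)]: the product of the three
    concatenations is a path starting in [U], so it meets [U] at a midpoint. *)
Lemma null_mul3 {M : PreDeltaMonoid} (x y z : M) f g h (U : M -> Prop) :
  null_at x f -> null_at y g -> null_at z h -> is_open U ->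
  U (pdm_op (pdm_op x y) z) ->
  exists k, U (pdm_op (pdm_op (f k (/ 2)) (g k (/ 2))) (h k (/ 2))).
Proof.
  intros Hf Hg Hh HU Hxyz.
  destruct (path_mid (fun t => pdm_op (pdm_op (concat x f t) (concat y g t)) (concat z h t)) U)
    as [k Hk]; auto.
  - apply (pdm_paths M (fun t => pdm_op (concat x f t) (concat y g t))).
    + apply pdm_paths; apply concat_cont; auto.
    + apply concat_cont; auto.
  - rewrite !concat_out by apply no_gap_0. exact Hxyz.
  - exists k. rewrite !concat_mid in Hk. exact Hk.
Qed.

(** Running along [f j] from 0 to [y] and back gives a loop through [f j y] inside the image of
    [f j]; the bound [k <= j] transfers the null property. *)
Lemma null_at_subloops {X : TopSpace} (x : X) f (p : nat -> X) :
  null_at x f -> (forall k, exists j y, (k <= j)%nat /\ inI y /\ p k = f j y) ->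
  exists g, null_at x g /\ forall k, g k (/ 2) = p k.
Proof.
  intros [Hl Hn] Hp. apply choice in Hp. destruct Hp as [j Hp].
  apply choice in Hp. destruct Hp as [y Hp].
  exists (fun k t => f (j k) (spike 0 (y k) t)).
  assert (I0 : inI 0) by (unfold inI; lra). split; [split|].
  - intros k. destruct (Hp k) as (_ & Hy & _). destruct (Hl (j k)) as (Hc & E0 & _).
    destruct (spike_ends 0 (y k)) as (S0 & S1 & _).
    split; [|rewrite S0, S1; auto].
    apply cont_I_comp with 2; auto; [lra|intros; apply spike_in; auto|].
    intros; apply spike_lip; auto.
  - intros U HU Hx. destruct (Hn U HU Hx) as [N HN]. exists N. intros k Hk t Ht.
    destruct (Hp k) as (Hj & Hy & _). apply HN; [lia|apply spike_in; auto].
  - intros k. destruct (Hp k) as (_ & _ & ->).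
    destruct (spike_ends 0 (y k)) as (_ & _ & ->). reflexivity.
Qed.

(** Spikes in the parameter from [x0] are carried to small loops by continuity of [c] there; the
    second alternative gives a constant spike. *)
Lemma null_at_along_path {X : TopSpace} (c : R -> X) (x0 : R) (u : nat -> R) (p : nat -> X) :
  cont_I c -> inI x0 -> (forall k, inI (u k) /\ Rabs (u k - x0) < / INR (S k)) ->
  (forall k, p k = c (u k) \/ p k = c x0) ->
  exists g, null_at (c x0) g /\ forall k, g k (/ 2) = p k.
Proof.
  intros Hc Hx0 Hu Hp.
  assert (Hw : forall k, exists w, (w = u k \/ w = x0) /\ p k = c w).
  { intros k. destruct (Hp k); eauto. }
  apply choice in Hw. destruct Hw as [w Hw].
  assert (Hwk : forall k, inI (w k) /\ Rabs (w k - x0) < / INR (S k)).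
  { intros k. destruct (Hw k) as [[-> | ->] _]; auto. split; auto.
    replace (x0 - x0) with 0 by ring. rewrite Rabs_R0. apply inv_S_bounds. }
  exists (fun k t => c (spike x0 (w k) t)). split; [split|].
  - intros k. destruct (Hwk k) as [Iw _]. destruct (spike_ends x0 (w k)) as (S0 & S1 & _).
    split; [|rewrite S0, S1; auto].
    apply cont_I_comp with 2; auto; [lra|intros; apply spike_in; auto|].
    intros; apply spike_lip; auto.
  - intros U HU Hx. destruct (Hc U HU x0 Hx0 Hx) as (e & He & H).
    destruct (inv_S_small e He) as [N HN]. exists N. intros k Hk t Ht.
    destruct (Hwk k) as [Iw Dw]. specialize (HN k Hk).
    pose proof (spike_near x0 (w k) t Ht).
    apply H; [apply spike_in; auto|lra].
  - intros k. destruct (Hw k) as [_ ->].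
    destruct (spike_ends x0 (w k)) as (_ & _ & ->). reflexivity.
Qed.

(** * The homotopy over dyadic time strips *)

Definition tau (n : nat) : R := 1 - (/ 2) ^ n.

Lemma tau_S n : tau (S n) = tau n + (/ 2) ^ S n.
Proof. unfold tau; simpl; lra. Qed.

Lemma tau_lt m n : (m < n)%nat -> tau m < tau n.
Proof.
  induction 1 as [|n _ IH]; rewrite tau_S;
    [assert (0 < (/ 2) ^ S m)|assert (0 < (/ 2) ^ S n)]; try (apply pow_lt; lra); lra.
Qed.

Lemma tau_le m n : (m <= n)%nat -> tau m <= tau n.
Proof.
  intros H. destruct (Nat.eq_dec m n) as [->|]; [lra|].
  left; apply tau_lt; lia.
Qed.

Lemma tau_lt_1 n : tau n < 1.
Proof. unfold tau. assert (0 < (/ 2) ^ n) by (apply pow_lt; lra). lra. Qed.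

Lemma strip_exists N t : 0 <= t -> t < tau N ->
  exists n, (n < N)%nat /\ tau n <= t <= tau (S n).
Proof.
  intros Ht. induction N as [|N IH]; intros H; [unfold tau in H; simpl in H; lra|].
  destruct (Rlt_dec t (tau N)) as [C|C].
  - destruct IH as (n & Hn & Hs); auto. exists n. split; auto.
  - exists N. split; [lia|lra].
Qed.

Lemma tau_above t : t < 1 -> exists N, t < tau N.
Proof.
  intros Ht. destruct (exists_pow_lt (/ 2) (1 - t)) as [N HN]; [lra|lra|].
  exists N. unfold tau. lra.
Qed.

Definition strip_coord (n : nat) (t : R) : R := clamp (2 ^ S n * (t - tau n)).

Lemma strip_coord_start n : strip_coord n (tau n) = 0.
Proof. apply clamp_le0. right; ring. Qed.

Lemma strip_coord_end n : strip_coord n (tau (S n)) = 1.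
Proof.
  apply clamp_ge1. right. rewrite tau_S, pow_inv.
  assert (2 ^ S n <> 0) by (apply pow_nonzero; lra). field; auto.
Qed.

Lemma strip_coord_lip n s t :
  Rabs (strip_coord n s - strip_coord n t) <= 2 ^ S n * Rabs (s - t).
Proof.
  eapply Rle_trans; [apply clamp_lip|]. right.
  replace (2 ^ S n * (s - tau n) - 2 ^ S n * (t - tau n)) with (2 ^ S n * (s - t)) by ring.
  rewrite Rabs_mult, (Rabs_pos_eq (2 ^ S n)); [reflexivity|apply pow_le; lra].
Qed.

Lemma Rabs_mul_inI a x : inI a -> Rabs (a * x) <= Rabs x.
Proof.
  intros Ha. unfold inI in Ha. rewrite Rabs_mult, (Rabs_pos_eq a) by lra.
  pose proof (Rabs_pos x). nra.
Qed.

(** Loops travel by interpolating their parameter between two gap coordinates, so no linear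
    structure on the space is involved. *)
Definition interp (a x y : R) : R := (1 - a) * x + a * y.

Lemma interp_in a x y : inI a -> inI x -> inI y -> inI (interp a x y).
Proof. unfold inI, interp. nra. Qed.

Lemma interp_lip a x y a' x' y' : inI a -> inI x' -> inI y' ->
  Rabs (interp a x y - interp a' x' y') <= Rabs (x - x') + Rabs (y - y') + Rabs (a - a').
Proof.
  intros Ha Hx Hy. unfold interp.
  replace ((1 - a) * x + a * y - ((1 - a') * x' + a' * y'))
    with ((1 - a) * (x - x') + a * (y - y') + (y' - x') * (a - a')) by ring.
  eapply Rle_trans; [apply Rabs_triang|]. apply Rplus_le_compat.
  - eapply Rle_trans; [apply Rabs_triang|].
    apply Rplus_le_compat; apply Rabs_mul_inI; unfold inI in *; lra.
  - rewrite Rabs_mult. assert (Rabs (y' - x') <= 1) by (unfold inI in *; split_Rabs; lra).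
    pose proof (Rabs_pos (y' - x')). pose proof (Rabs_pos (a - a')). nra.
Qed.

(** During strip [n] the loop [alpha n] travels from the [n]-th gap to gap [psi n]. *)
Definition transit {X : TopSpace} (alpha : nat -> R -> X) (psi : nat -> nat)
    (n : nat) (x t : R) : X :=
  alpha n (interp (strip_coord n t) (gap_coord n x) (gap_coord (psi n) x)).

Lemma transit_cont {X : TopSpace} (alpha : nat -> R -> X) psi n :
  cont_I (alpha n) -> cont_I2 (transit alpha psi n).
Proof.
  intros Ha. destruct (gap_coord_lip n) as (L1 & HL1 & H1).
  destruct (gap_coord_lip (psi n)) as (L2 & HL2 & H2).
  assert (HK : 0 < 2 ^ S n) by (apply pow_lt; lra).
  apply cont_I2_comp with (L := L1 + L2 + 2 ^ S n); auto; [lra| |].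
  - intros; apply interp_in; apply clamp_in.
  - intros s t s' t'. eapply Rle_trans; [apply interp_lip; apply clamp_in|].
    specialize (H1 s' s). specialize (H2 s' s). pose proof (strip_coord_lip n t' t).
    pose proof (Rabs_pos (s' - s)). pose proof (Rabs_pos (t' - t)). nra.
Qed.

Definition not_yet_moved {M : PreDeltaMonoid} (alpha : nat -> R -> M) (n : nat) : R -> M :=
  concat pdm_e (keep pdm_e (fun j => Nat.ltb n j) alpha).

(** Gap [j] receives loop [phi j]. The strict comparisons here and in [not_yet_moved] leave loop [n]
    to [transit]. *)
Definition already_moved {M : PreDeltaMonoid} (alpha : nat -> R -> M) (phi : nat -> nat)
    (n : nat) : R -> M :=
  concat pdm_e (keep pdm_e (fun j => Nat.ltb (phi j) n) (fun j => alpha (phi j))).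

Definition strip_map {M : PreDeltaMonoid} (alpha : nat -> R -> M) (phi psi : nat -> nat)
    (n : nat) (x t : R) : M :=
  pdm_op (pdm_op (not_yet_moved alpha n x) (transit alpha psi n x t))
    (already_moved alpha phi n x).

(** A time shared by two strips causes no ambiguity, by [strip_map_match]; no strip contains
    [t = 1], where the default branch supplies the final concatenation. *)
Definition moving {M : PreDeltaMonoid} (alpha : nat -> R -> M) (phi psi : nat -> nat)
    (x t : R) : M :=
  match excluded_middle_informative (exists n, tau n <= t <= tau (S n)) with
  | left H => strip_map alpha phi psi (proj1_sig (constructive_indefinite_description _ H)) x t
  | right _ => concat pdm_e (fun j => alpha (phi j)) x
  end.

Lemma strip_map_cont {M : PreDeltaMonoid} (alpha : nat -> R -> M) phi psi n :
  null_at pdm_e alpha -> (forall m, psi (phi m) = m) ->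
  cont_I2 (strip_map alpha phi psi n).
Proof.
  intros Ha Hpsi.
  apply (cont_I2_mul (fun x t => pdm_op (not_yet_moved alpha n x) (transit alpha psi n x t))
    (fun x _ => already_moved alpha phi n x)).
  - apply (cont_I2_mul (fun x _ => not_yet_moved alpha n x)).
    + apply cont_I2_fst, concat_cont, keep_null, Ha.
    + apply transit_cont, Ha.
  - apply cont_I2_fst, concat_cont, keep_null.
    apply (null_at_reindex _ _ phi psi); auto.
Qed.

(** Loop [S n] splits off the right of the waiting layer and loop [n] joins the moved layer from the
    left. Both sides are then one product of four factors, bracketed differently, thanks to the
    order of the layers in [strip_map]. *)
Lemma strip_map_match {M : PreDeltaMonoid} (alpha : nat -> R -> M) phi psi n x :
  (forall m, is_loop (alpha m)) ->
  (forall m, psi (phi m) = m) -> (forall m, phi (psi m) = m) ->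
  strip_map alpha phi psi n x (tau (S n)) = strip_map alpha phi psi (S n) x (tau (S n)).
Proof.
  intros Hl Hpsi Hphi. unfold strip_map, transit.
  rewrite strip_coord_end, strip_coord_start.
  replace (interp 1 (gap_coord n x) (gap_coord (psi n) x)) with (gap_coord (psi n) x)
    by (unfold interp; ring).
  replace (interp 0 (gap_coord (S n) x) (gap_coord (psi (S n)) x)) with (gap_coord (S n) x)
    by (unfold interp; ring).
  assert (Eu : not_yet_moved alpha n x =
    pdm_op (not_yet_moved alpha (S n) x) (alpha (S n) (gap_coord (S n) x))).
  { unfold not_yet_moved.
    replace (alpha (S n)) with (keep pdm_e (fun j => Nat.ltb n j) alpha (S n))
      by (unfold keep; rewrite (proj2 (Nat.ltb_lt n (S n))); auto).
    apply concat_peel; unfold keep.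
    - rewrite (proj2 (Nat.ltb_lt n (S n))); auto.
    - intros s. rewrite Nat.ltb_irrefl. reflexivity.
    - intros i Hi s. destruct (Nat.ltb_spec n i), (Nat.ltb_spec (S n) i); auto; lia. }
  assert (Ev : already_moved alpha phi (S n) x =
    pdm_op (alpha n (gap_coord (psi n) x)) (already_moved alpha phi n x)).
  { unfold already_moved.
    replace (alpha n) with (keep pdm_e (fun j => Nat.ltb (phi j) (S n))
      (fun j => alpha (phi j)) (psi n))
      by (unfold keep; rewrite Hphi, (proj2 (Nat.ltb_lt n (S n))); auto).
    apply concat_peel; unfold keep.
    - rewrite Hphi, (proj2 (Nat.ltb_lt n (S n))); auto.
    - intros s. rewrite Hphi, Nat.ltb_irrefl. reflexivity.
    - intros i Hi s. assert (phi i <> n) by (intros C; apply Hi; rewrite <- C; auto).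
      destruct (Nat.ltb_spec (phi i) (S n)), (Nat.ltb_spec (phi i) n); auto; lia. }
  rewrite Eu, Ev, pdm_assoc. reflexivity.
Qed.

Lemma moving_strip {M : PreDeltaMonoid} (alpha : nat -> R -> M) phi psi n x t :
  (forall m, is_loop (alpha m)) ->
  (forall m, psi (phi m) = m) -> (forall m, phi (psi m) = m) ->
  tau n <= t <= tau (S n) -> moving alpha phi psi x t = strip_map alpha phi psi n x t.
Proof.
  intros Hl Hpsi Hphi Ht. unfold moving.
  destruct (excluded_middle_informative _) as [H|H]; [|exfalso; eauto].
  destruct (constructive_indefinite_description _ H) as [m Hm]; simpl.
  (* Distinct strips sharing a time are adjacent and meet only in their common endpoint. *)
  assert (Hadj : forall m n, tau m <= t <= tau (S m) -> tau n <= t <= tau (S n) ->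
    (m < n)%nat -> strip_map alpha phi psi m x t = strip_map alpha phi psi n x t).
  { clear m n Ht H Hm. intros m n Hm Hn Hlt.
    destruct (Nat.eq_dec n (S m)) as [->|Hne].
    - assert (t = tau (S m)) as -> by lra. apply strip_map_match; auto.
    - assert (Hsm : (S m < n)%nat) by lia. pose proof (tau_lt (S m) n Hsm). lra. }
  destruct (lt_eq_lt_dec m n) as [[C| ->]|C]; auto. symmetry; auto.
Qed.

Lemma moving_1 {M : PreDeltaMonoid} (alpha : nat -> R -> M) phi psi x :
  moving alpha phi psi x 1 = concat pdm_e (fun j => alpha (phi j)) x.
Proof.
  unfold moving. destruct (excluded_middle_informative _) as [[n Hn]|H]; auto.
  exfalso. pose proof (tau_lt_1 (S n)). lra.
Qed.

Lemma moving_0 {M : PreDeltaMonoid} (alpha : nat -> R -> M) phi psi x :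
  (forall m, is_loop (alpha m)) ->
  (forall m, psi (phi m) = m) -> (forall m, phi (psi m) = m) ->
  moving alpha phi psi x 0 = concat pdm_e alpha x.
Proof.
  intros Hl Hpsi Hphi. assert (E0 : tau 0 = 0) by (unfold tau; simpl; ring).
  rewrite (moving_strip alpha phi psi 0) by (auto; pose proof (tau_lt 0 1 Nat.lt_0_1); lra).
  unfold strip_map, transit. rewrite <- E0, strip_coord_start.
  replace (interp 0 (gap_coord 0 x) (gap_coord (psi 0%nat) x)) with (gap_coord 0 x)
    by (unfold interp; ring).
  (* No index satisfies [phi j < 0], so nothing has been moved yet. *)
  replace (already_moved alpha phi 0 x) with (@pdm_e M).
  - rewrite pdm_idr. symmetry. apply concat_peel; auto.
    intros i Hi s. unfold keep. destruct (Nat.ltb_spec 0 i); auto; lia.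
  - unfold already_moved. destruct (classic (exists j, in_gap j x)) as [[j Hj]|Hn].
    + rewrite (concat_gap _ _ j x Hj). reflexivity.
    + rewrite concat_out; auto.
Qed.

(** No gap contains 0 or 1, and every gap coordinate fixes both, so the loop in transit is at an end
    of its parameter interval. *)
Lemma moving_ends {M : PreDeltaMonoid} (alpha : nat -> R -> M) phi psi t :
  (forall m, is_loop (alpha m)) ->
  moving alpha phi psi 0 t = pdm_e /\ moving alpha phi psi 1 t = pdm_e.
Proof.
  intros Hl. unfold moving. destruct (excluded_middle_informative _) as [H|H].
  - set (n := proj1_sig _). destruct (Hl n) as (_ & A0 & A1).
    unfold strip_map, not_yet_moved, already_moved, transit.
    rewrite !concat_out by (apply no_gap_0 || apply no_gap_1).
    rewrite !gap_coord_0, !gap_coord_1, !pdm_idr, !pdm_idl.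
    split.
    + replace (interp _ 0 0) with 0 by (unfold interp; ring). exact A0.
    + replace (interp _ 1 1) with 1 by (unfold interp; ring). exact A1.
  - rewrite !concat_out by (apply no_gap_0 || apply no_gap_1). auto.
Qed.

(** In gap [i] only loop [phi i] counts, and it has arrived once [n > phi i]. If [x0] lies in no
    gap, the final value there is the identity, and each gap is either already filled or still
    constant at the identity. *)
Lemma already_moved_near {M : PreDeltaMonoid} (alpha : nat -> R -> M) phi x0 :
  exists N e, 0 < e /\ forall n x, (N <= n)%nat -> Rabs (x - x0) < e ->
    already_moved alpha phi n x = concat pdm_e (fun j => alpha (phi j)) x \/
    already_moved alpha phi n x = concat pdm_e (fun j => alpha (phi j)) x0.
Proof.
  unfold already_moved. destruct (classic (exists i, in_gap i x0)) as [[i Hi]|Hn].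
  - destruct (in_gap_nbhd i x0 Hi) as (e & He & H).
    exists (S (phi i)), e. split; auto. intros n x Hle Hx. left.
    rewrite !(concat_gap _ _ i x (H x Hx)). unfold keep.
    rewrite (proj2 (Nat.ltb_lt (phi i) n)); auto.
  - exists 0%nat, 1. split; [lra|]. intros n x _ _.
    rewrite (concat_out _ _ x0) by exact Hn.
    destruct (classic (exists j, in_gap j x)) as [[j Hj]|Hx].
    + rewrite !(concat_gap _ _ j x Hj). unfold keep. destruct (Nat.ltb _ _); auto.
    + rewrite concat_out; auto.
Qed.

(* A sequence of bad points would be hit by one path: concatenate, over the gaps, loops
   through the three factors; their pointwise product is a path, by [null_mul3]. *)
Lemma strip_map_limit {M : PreDeltaMonoid} (alpha : nat -> R -> M) phi psi x0 (U : M -> Prop) :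
  null_at pdm_e alpha -> (forall m, psi (phi m) = m) ->
  inI x0 -> is_open U -> U (concat pdm_e (fun j => alpha (phi j)) x0) ->
  exists N e, 0 < e /\ forall n x t, (N <= n)%nat -> inI x -> inI t -> Rabs (x - x0) < e ->
    U (strip_map alpha phi psi n x t).
Proof.
  intros Ha Hpsi Hx0 HU HUx. apply NNPP. intros Hbad.
  destruct (already_moved_near alpha phi x0) as (N0 & e0 & He0 & Hv).
  (* The bound [N0 + k] on the strip both makes [Hv] applicable and forces the waiting and
     travelling loops to have index at least [k]. *)
  assert (Hz : forall k : nat, exists n x t, (N0 + k <= n)%nat /\ inI x /\ inI t /\
    Rabs (x - x0) < e0 /\ Rabs (x - x0) < / INR (S k) /\ ~ U (strip_map alpha phi psi n x t)).
  { intros k. apply NNPP. intros C. apply Hbad.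
    exists (N0 + k)%nat, (Rmin e0 (/ INR (S k))).
    split; [apply Rmin_glb_lt; auto; apply inv_S_bounds|].
    intros n x t Hn Hx Ht Hd. apply NNPP. intros C'. apply C. exists n, x, t.
    pose proof (Rmin_l e0 (/ INR (S k))). pose proof (Rmin_r e0 (/ INR (S k))).
    repeat split; auto; try apply Hx; try apply Ht; lra. }
  apply choice in Hz. destruct Hz as [n Hz].
  apply choice in Hz. destruct Hz as [x Hz].
  apply choice in Hz. destruct Hz as [t Hz].
  assert (E0 : forall j, alpha j 0 = pdm_e) by (intros j; apply (proj1 Ha)).
  assert (I0 : inI 0) by (unfold inI; lra).
  destruct (null_at_subloops pdm_e alpha (fun k => not_yet_moved alpha (n k) (x k)) Ha)
    as (f & Hf & Ef).
  { intros k. destruct (Hz k) as (Hn & _). unfold not_yet_moved.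
    destruct (classic (exists j, in_gap j (x k))) as [[j Hj]|Hno].
    - rewrite (concat_gap _ _ j _ Hj). unfold keep.
      destruct (Nat.ltb_spec (n k) j).
      + exists j, (gap_coord j (x k)). repeat split; try apply clamp_in. lia.
      (* Here [alpha k 0] is the identity, written as a point of a loop of large enough index. *)
      + exists k, 0. auto.
    - rewrite concat_out by exact Hno. exists k, 0. auto. }
  destruct (null_at_subloops pdm_e alpha (fun k => transit alpha psi (n k) (x k) (t k)) Ha)
    as (g & Hg & Eg).
  { intros k. destruct (Hz k) as (Hn & _). eexists (n k), _.
    split; [lia|]. split; [|reflexivity]. apply interp_in; apply clamp_in. }
  destruct (null_at_along_path (concat pdm_e (fun j => alpha (phi j))) x0 x
    (fun k => already_moved alpha phi (n k) (x k))) as (h & Hh & Eh); auto.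
  { apply concat_cont, (null_at_reindex _ _ phi psi); auto. }
  { intros k. destruct (Hz k) as (_ & Hx & _ & _ & Hd & _). auto. }
  { intros k. destruct (Hz k) as (Hn & _ & _ & Hd & _). apply Hv; auto; lia. }
  destruct (null_mul3 _ _ _ f g h U Hf Hg Hh HU) as [k Hk].
  - rewrite !pdm_idl. exact HUx.
  - rewrite Ef, Eg, Eh in Hk. destruct (Hz k) as (_ & _ & _ & _ & _ & Hno). auto.
Qed.

(** For [t < 1] finitely many closed strips are pasted; at [t = 1], [strip_map_limit] handles all
    late strips at once. *)
Lemma moving_cont {M : PreDeltaMonoid} (alpha : nat -> R -> M) phi psi :
  null_at pdm_e alpha ->
  (forall m, psi (phi m) = m) -> (forall m, phi (psi m) = m) ->
  cont_I2 (moving alpha phi psi).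
Proof.
  intros Ha Hpsi Hphi U HU x t Hx Ht HUxt.
  assert (Hstrip : forall n y s, tau n <= s <= tau (S n) ->
    moving alpha phi psi y s = strip_map alpha phi psi n y s)
    by (intros; apply moving_strip; auto; apply Ha).
  destruct (Rlt_dec t 1) as [Hlt|Hge].
  - destruct (tau_above t Hlt) as [N HN].
    destruct (min_radius (fun n e => forall y s, inI y -> inI s ->
      Rabs (y - x) < e -> Rabs (s - t) < e -> tau n <= s <= tau (S n) ->
      U (strip_map alpha phi psi n y s)) N) as (e & He & H).
    + intros n e e' H Hee y s Hy Hs Dy Ds. apply H; auto; lra.
    (* A strip missing [t] gets a radius that makes its condition vacuous. *)
    + intros n _. destruct (Rlt_dec t (tau n)) as [C1|C1].
      { exists (tau n - t). split; [lra|]. intros y s _ _ _ Ds Hs.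
        revert Ds; split_Rabs; lra. }
      destruct (Rlt_dec (tau (S n)) t) as [C2|C2].
      { exists (t - tau (S n)). split; [lra|]. intros y s _ _ _ Ds Hs.
        revert Ds; split_Rabs; lra. }
      rewrite (Hstrip n) in HUxt by lra.
      destruct (strip_map_cont alpha phi psi n Ha Hpsi U HU x t Hx Ht HUxt)
        as (e & He & H).
      exists e. auto.
    + exists (Rmin e (tau N - t)). split; [apply Rmin_glb_lt; lra|].
      intros y s Hy Hs Dy Ds.
      pose proof (Rmin_l e (tau N - t)). pose proof (Rmin_r e (tau N - t)).
      destruct (strip_exists N s) as (n & Hn & Hsn);
        [apply Hs|revert Ds; split_Rabs; lra|].
      rewrite (Hstrip n) by auto. apply H; auto; lra.
  - assert (t = 1) as -> by (unfold inI in Ht; lra).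
    rewrite moving_1 in HUxt.
    destruct (strip_map_limit alpha phi psi x U Ha Hpsi Hx HU HUxt) as (N & e1 & He1 & H1).
    assert (Hc : cont_I (concat pdm_e (fun j => alpha (phi j))))
      by (apply concat_cont, (null_at_reindex _ _ phi psi); auto).
    destruct (Hc U HU x Hx HUxt) as (e2 & He2 & H2).
    pose proof (tau_lt_1 N).
    (* The bound [1 - tau N] forces [s > tau N], hence a strip of index at least [N]. *)
    exists (Rmin (Rmin e1 e2) (1 - tau N)).
    split; [repeat apply Rmin_glb_lt; lra|]. intros y s Hy Hs Dy Ds.
    pose proof (Rmin_l (Rmin e1 e2) (1 - tau N)). pose proof (Rmin_r (Rmin e1 e2) (1 - tau N)).
    pose proof (Rmin_l e1 e2). pose proof (Rmin_r e1 e2).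
    destruct (Rlt_dec s 1) as [Hs1|Hs1].
    + destruct (tau_above s Hs1) as [N' HN'].
      destruct (strip_exists N' s) as (n & Hn & Hsn); [apply Hs|auto|].
      rewrite (Hstrip n) by auto. apply H1; auto; [|lra].
      apply Nat.nlt_ge. intros C. pose proof (tau_le (S n) N C).
      revert Ds; split_Rabs; lra.
    + assert (s = 1) as -> by (unfold inI in Hs; lra).
      rewrite moving_1. apply H2; auto; lra.
Qed.

Theorem mainTheorem14 (M : PreDeltaMonoid) (b : M) (alpha : nat -> R -> M)
    (beta beta' : R -> M) (phi : nat -> nat) :
  path_connected M ->
  null_sequence alpha ->
  is_path beta pdm_e b -> is_path beta' pdm_e b ->
  path_homotopic beta beta' ->
  (forall m n, phi m = phi n -> m = n) -> (forall m, exists n, phi n = m) ->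
  path_homotopic (slide beta alpha) (slide beta' (fun n => alpha (phi n))).
Proof.
  intros _ Ha _ _ (K & HK & K0 & K1 & Kl & Kr) Hinj Hsurj.
  (* Choice gives a right inverse of [phi]; injectivity makes it two-sided. *)
  destruct (choice _ Hsurj) as [psi Hphi].
  assert (Hpsi : forall m, psi (phi m) = m) by (intros m; apply Hinj; auto).
  assert (Hl : forall m, is_loop (alpha m)) by apply Ha.
  (* [K] composed with [Gamma] deforms the [beta] factor while [moving] permutes the loops. *)
  exists (fun s t => pdm_op (K (Gamma s) t) (moving alpha phi psi s t)).
  repeat split.
  - apply cont_I2_mul.
    + intros U HU s t Hs Ht HUst.
      destruct (HK U HU (Gamma s) t (Gamma_in s) Ht HUst) as (e & He & H).
      destruct (Gamma_continuous e He) as (d & Hd & HG).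
      exists (Rmin d e). split; [apply Rmin_glb_lt; auto|]. intros s' t' Hs' Ht' Ds Dt.
      pose proof (Rmin_l d e). pose proof (Rmin_r d e).
      apply H; auto; [apply Gamma_in|apply HG; lra|lra].
    + apply moving_cont; auto.
  - intros s Hs. rewrite slide_concat, K0, moving_0 by (auto; apply Gamma_in). reflexivity.
  - intros s Hs. rewrite slide_concat, K1, moving_1 by apply Gamma_in. reflexivity.
  - intros t Ht. rewrite slide_concat, concat_out, Gamma_0 by apply no_gap_0.
    rewrite Kl by auto. f_equal. apply moving_ends; auto.
  - intros t Ht. rewrite slide_concat, concat_out, Gamma_1 by apply no_gap_1.
    rewrite Kr by auto. f_equal. apply moving_ends; auto.
Qed.
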